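(* Let $\lambda\in(0,1)$, let $\alpha,\beta$ be real numbers with $0<\alpha<\frac1\lambda$ and $\beta>0$, and let $X\sim\Gamma_\lambda(\alpha,\beta)$ be a degenerate gamma random variable with parameters $\alpha$ and $\beta$. Then we have $$\mathrm{Var}(X)=\frac{\alpha}{\beta^2}\left(\frac{1-\lambda}{\big(1-\lambda(\alpha+1)\big)^2\big(1-\lambda(\alpha+2)\big)}\right).$$
   Context: Fix $\lambda\in(0,1)$. For real $x$ put $(x)_{0,\lambda}=1$ and $(x)_{n,\lambda}=x(x-\lambda)(x-2\lambda)\cdots(x-(n-1)\lambda)$ for $n\ge1$. The degenerate exponential function is $e_\lambda^{x}(t)=\sum_{n=0}^\infty (x)_{n,\lambda}\frac{t^n}{n!}$, i.e. $e_\lambda^x(t)=(1+\lambda t)^{x/\lambda}$, so that $e_\lambda^{-1}(t)=(1+\lambda t)^{-1/\lambda}$ for $t\ge0$. The degenerate gamma function is $\Gamma_\lambda(s)=\int_0^\infty e_\lambda^{-1}(t)\,t^{s-1}\,dt$ for $s\in\mathbb{C}$ with $0<\mathrm{Re}(s)<\frac1\lambda$. For $0<\alpha<\frac1\lambda$ and $\beta>0$, a continuous random variable $X$ is a degenerate gamma random variable with parameters $\alpha$ and $\beta$, written $X\sim\Gamma_\lambda(\alpha,\beta)$, if its probability density function is $$f_\lambda(x)=\frac{1}{\Gamma_\lambda(\alpha)}\,\beta\, e_\lambda^{-1}(\beta x)(\beta x)^{\alpha-1}\ \text{ for } x>0,\qquad f_\lambda(x)=0\ \text{ otherwise.}$$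 Here $E[X^n]=\int_{-\infty}^\infty x^n f_\lambda(x)\,dx$ for $n\ge1$, and the variance is $\mathrm{Var}(X)=E\big[(X-E[X])^2\big]=E[X^2]-(E[X])^2$.
   Formalization: The formal theorem additionally assumes that X is square-integrable (equivalently α+2<1/λ); for 1/λ−2≤α<1/λ the variance is infinite or undefined while the right-hand side is finite, negative or undefined, so the claim fails there. *)

(* Defs.v *)
From HB Require Import structures.
From mathcomp Require Import all_boot all_order all_algebra.
From mathcomp Require Import all_classical all_reals all_analysis.

Set Implicit Arguments.
Unset Strict Implicit.
Unset Printing Implicit Defensive.

Import Order.TTheory GRing.Theory Num.Theory.
Import numFieldNormedType.Exports.

Local Open Scope classical_set_scope.
Local Open Scope ring_scope.

(* The degenerate exponential e_lam^x(t), in closed form: the series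
   \sum_n (x)_{n,lam} t^n / n! generally diverges for t > 1 / lam, whereas the
   gamma integral and the density below need every t > 0. *)
Definition degenerate_exp (R : realType) (lam x t : R) : R :=
  (1 + lam * t) `^ (x / lam).

(* The integral converges for 0 < s < 1 / lam; elsewhere the value is not
   meaningful. Only real arguments s are considered. *)
Definition degenerate_gamma_fun (R : realType) (lam s : R) : R :=
  \int[@lebesgue_measure R]_(t in `]0, +oo[)
    (degenerate_exp lam (- 1) t * t `^ (s - 1)).

Definition degenerate_gamma_pdf (R : realType) (lam a b x : R) : R :=
  if 0 < x then
    1 / degenerate_gamma_fun lam a *
    (b * degenerate_exp lam (- 1) (b * x) * (b * x) `^ (a - 1))
  else 0.

Definition has_density (d : measure_display) (T : measurableType d)
    (R : realType) (P : probability T R) (X : {RV P >-> R}) (f : R -> R) : Prop :=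
  [/\ measurable_fun [set: R] f,
      forall x, 0 <= f x &
      forall A : set R, measurable A ->
        distribution P X A = (\int[@lebesgue_measure R]_(x in A) (f x)%:E)%E].

Definition degenerate_gamma_rv (d : measure_display) (T : measurableType d)
    (R : realType) (P : probability T R) (lam a b : R) (X : {RV P >-> R}) : Prop :=
  has_density X (degenerate_gamma_pdf lam a b).

(* Main.v *)
(* Put c = lam b, q = 1 / lam and w_s(x) = x^s (1 + c x)^(-q). Up to a constant
   the density is w_(a - 1), so that E[X^n] is proportional to M_(a - 1 + n), where
   M_s is the integral of w_s over the positive half-line. The function
   F(x) = x^s (1 + c x)^(1 - q) satisfies F' = s w_(s - 1) - c (q - 1 - s) w_s and
   vanishes at 0 and at infinity as soon as M_(s - 1) and M_s are finite, whence
   s M_(s - 1) = c (q - 1 - s) M_s. Taking s = a and s = a + 1 gives both moments.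
   Square integrability of X makes these integrals finite, and the recurrences
   then force 1 - lam (a + 1) and 1 - lam (a + 2) to be nonzero; the gamma
   function itself is never computed, as it cancels against the total mass. *)
Require Import Defs.
From HB Require Import structures.
From mathcomp Require Import all_boot all_order all_algebra.
From mathcomp Require Import all_classical all_reals all_analysis.
From mathcomp Require Import measurable_realfun ring lra.
Import Order.TTheory GRing.Theory Num.Theory.
Import numFieldNormedType.Exports.
Local Open Scope classical_set_scope.
Local Open Scope ring_scope.

(** * Exhaustion of the half-line by compact intervals, and real powers *)

Section real_integrals.
Context {R : realType}.
Local Notation mu := (@lebesgue_measure R).

(** These compact intervals stay away from 0, where kernels with a negative exponent are
    singular. *)
Lemma bigcup_itv_inv_nat :
  \bigcup_n `[n.+1%:R^-1, n.+1%:R]%classic = `]0, +oo[%classic :> set R.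
Proof.
apply/seteqP; split => [x [n _]|x]; rewrite /= !in_itv/= andbT.
  by move=> /andP[nx _]; exact: lt_le_trans nx.
move=> x0.
exists (Num.truncn (Num.max x x^-1)) => //=.
have := Num.Theory.truncnS_gt (Num.max x x^-1).
rewrite gt_max => /andP[xn xVn]; rewrite in_itv/= (ltW xn) andbT.
by rewrite invf_ple ?posrE// ltW.
Qed.

Lemma nondecreasing_itv_inv_nat :
  nondecreasing_seq (fun n => `[n.+1%:R^-1, n.+1%:R]%classic : set R).
Proof.
move=> m n mn; rewrite subsetEset; apply: subset_itv; rewrite bnd_simp.
  by rewrite lef_pV2 ?posrE// ler_nat.
by rewrite ler_nat.
Qed.

(** Monotone convergence; integrability makes the limit finite, so it passes to real values. *)
Lemma cvg_Rintegral_itv_inv_nat (f : R -> R) :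
  (forall x, 0 < x -> 0 <= f x) ->
  mu.-integrable `]0, +oo[ (EFin \o f) ->
  \int[mu]_(x in `[n.+1%:R^-1, n.+1%:R]) f x @[n --> \oo] -->
  \int[mu]_(x in `]0, +oo[) f x.
Proof.
move=> f0 intf; apply: fine_cvg; rewrite fineK ?integrable_fin_num//.
rewrite -bigcup_itv_inv_nat.
have sub n : `[n.+1%:R^-1, n.+1%:R]%classic `<=` (`]0, +oo[ : set R).
  by move=> x nx; rewrite -bigcup_itv_inv_nat; exists n.
apply: ge0_nondecreasing_set_cvg_integral => //.
- exact: nondecreasing_itv_inv_nat.
- by move=> n; exact: measurable_funS (sub n) (measurable_int _ intf).
- by move=> n x /sub; rewrite /= in_itv/= andbT lee_fin => /f0.
Qed.

(* Unlike [mulr_powRB1], the exponent may be negative. *)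
Lemma mul_powRB1 (r : R) {x : R} : 0 < x -> x `^ r = x * x `^ (r - 1).
Proof.
move=> x0; rewrite powRB ?(gt_eqF x0) ?implybT// (powRr1 (ltW x0)).
by rewrite mulrC divfK// gt_eqF.
Qed.

Lemma le0_ler_powR r (x y : R) : r <= 0 -> 0 < x -> x <= y -> y `^ r <= x `^ r.
Proof.
move=> r0 x0 xy; have y0 := lt_le_trans x0 xy.
rewrite -[r]opprK !(powRN _ (- r)) lef_pV2 ?posrE ?powR_gt0//.
by rewrite ge0_ler_powR ?oppr_ge0// nnegrE ltW.
Qed.

Lemma le_Rintegral_subset (A B : set R) (f : R -> R) :
  measurable A -> measurable B -> A `<=` B -> mu.-integrable B (EFin \o f) ->
  (forall x, B x -> 0 <= f x) ->
  \int[mu]_(x in A) f x <= \int[mu]_(x in B) f x.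
Proof.
move=> mA mB AB intf f0; rewrite /Rintegral fine_le//.
- by rewrite integrable_fin_num//; exact: integrableS intf.
- exact: integrable_fin_num.
- by apply: ge0_subset_integral => //; exact: measurable_int intf.
Qed.

End real_integrals.

(** * The beta prime kernel and its moment recurrence *)

Section beta_prime.
Context {R : realType}.
Local Notation mu := (@lebesgue_measure R).

(** Up to normalization and scaling by c, the beta prime density with shape parameters s + 1 and q -
    s - 1. The primitive F is the member with q lowered by one. *)
Definition beta_prime_kernel (c q s x : R) : R := x `^ s * (1 + c * x) `^ (- q).
Local Notation w := beta_prime_kernel.

Context {c : R}.
Hypothesis c_gt0 : 0 < c.

Lemma beta_prime_kernel_ge0 q s x : 0 <= w c q s x.
Proof. by rewrite mulr_ge0// powR_ge0. Qed.

(** After the product rule, one factor 1 + c x is split off (1 + c x)^(1 - q), so that only kernels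
    with parameter q remain. *)
Lemma is_derive_beta_prime_primitive (q s : R) {x : R} : 0 < x ->
  is_derive x 1 (w c (q - 1) s)
    (s * w c q (s - 1) x - c * (q - 1 - s) * w c q s x).
Proof.
move=> x0.
have y0 : 0 < 1 + c * x by rewrite addr_gt0// mulr_gt0.
have dp : is_derive x 1 (fun z => z `^ s) (s * x `^ (s - 1)).
  exact: is_derive1_powR.
have dl : is_derive x 1 (fun z => 1 + c * z) c.
  by apply: is_derive_eq; rewrite /GRing.scale/=; ring.
have dr : is_derive x 1 (fun z => (1 + c * z) `^ (- (q - 1)))
    (- (q - 1) * (1 + c * x) `^ (- q) * c).
  apply: (@is_derive1_comp _ (fun y => y `^ (- (q - 1))) (fun z => 1 + c * z)).
  by have := is_derive1_powR (- (q - 1)) y0; rewrite opprB addrAC subrr add0r.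
apply: (is_derive_eq (is_deriveM dp dr)); rewrite /GRing.scale/=.
rewrite /beta_prime_kernel opprB (mul_powRB1 (1 - q) y0) (mul_powRB1 s x0).
rewrite addrAC subrr add0r; ring.
Qed.

Lemma continuous_beta_prime_kernel q s x : 0 < x -> {for x, continuous (w c q s)}.
Proof.
move=> x0; apply: differentiable_continuous; apply/derivable1_diffP.
(* Every kernel is itself a primitive, for the parameter q + 1. *)
have := is_derive_beta_prime_primitive (q + 1) s x0.
by rewrite addrK => ?; exact: ex_derive.
Qed.

Lemma within_continuous_beta_prime_kernel q s {m} n : 0 < m ->
  {within `[m, n], continuous (w c q s)}.
Proof.
move=> m0; apply: continuous_in_subspaceT => x /set_mem/=.
rewrite in_itv/= => /andP[mx _].
by apply: continuous_beta_prime_kernel; exact: lt_le_trans mx.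
Qed.

Lemma integrable_beta_prime_itv q s {m} n : 0 < m ->
  mu.-integrable `[m, n] (EFin \o w c q s).
Proof.
move=> m0; apply: continuous_compact_integrable; first exact: segment_compact.
exact: within_continuous_beta_prime_kernel.
Qed.

Lemma Rintegral_beta_prime_itv q s m n : 0 < m -> m < n ->
  s * (\int[mu]_(x in `[m, n]) w c q (s - 1) x) -
  c * (q - 1 - s) * (\int[mu]_(x in `[m, n]) w c q s x) =
  w c (q - 1) s n - w c (q - 1) s m.
Proof.
move=> m0 mn.
rewrite -!RintegralZl//; try exact: integrable_beta_prime_itv.
rewrite -RintegralB//=; last 2 first.
- by apply: (integrableZl _ s (integrable_beta_prime_itv _ _ _ m0)).
- by apply: (integrableZl _ _ (integrable_beta_prime_itv _ _ _ m0)).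
rewrite /Rintegral (@continuous_FTC2 _ _ (w c (q - 1) s)) -?EFinB//.
- apply: continuous_in_subspaceT => x /set_mem/=.
  rewrite in_itv/= => /andP[/(lt_le_trans m0) x0 _].
  by apply: cvgB; apply: cvgM;
    (exact: cvg_cst || exact: continuous_beta_prime_kernel).
- split.
  + move=> x; rewrite in_itv/= => /andP[mx _].
    have := is_derive_beta_prime_primitive q s (lt_trans m0 mx) => ?.
    exact: ex_derive.
  + by apply/cvg_at_right_filter; exact: continuous_beta_prime_kernel.
  + apply/cvg_at_left_filter; apply: continuous_beta_prime_kernel.
    exact: lt_trans mn.
- move=> x; rewrite in_itv/= => /andP[mx _].
  have := is_derive_beta_prime_primitive q s (lt_trans m0 mx) => ?.
  by rewrite derive1E derive_val.
Qed.

(** Here x^(s - 1) = x^s / x is at least n^s / (2 n), and 1 + c x is at most 2 (1 + c n), raised to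
    a nonpositive power; the constants combine to 2^(1 - q) / 2. *)
Lemma beta_prime_primitive_doubling q s (n x : R) : 1 <= q -> 0 < s ->
  0 < n -> n < x -> x <= 2 * n ->
  2 `^ (- q) * w c (q - 1) s n / n <= w c (q - 1) (s - 1) x.
Proof.
move=> q1 s0 n0 nx x2n.
have x0 := lt_trans n0 nx.
have y0 : 0 < 1 + c * n by rewrite addr_gt0// mulr_gt0.
have xs : n `^ s / (2 * n) <= x `^ (s - 1).
  rewrite powRB ?(gt_eqF x0) ?implybT// (powRr1 (ltW x0)).
  apply: ler_pM; rewrite ?powR_ge0 ?invr_ge0 ?mulr_ge0 ?(ltW n0)//.
    by rewrite ge0_ler_powR ?nnegrE ?(ltW s0) ?(ltW n0) ?(ltW x0) ?(ltW nx).
  by rewrite lef_pV2 ?posrE ?mulr_gt0.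
have ys : 2 `^ (1 - q) * (1 + c * n) `^ (- (q - 1)) <=
    (1 + c * x) `^ (- (q - 1)).
  rewrite opprB -powRM ?(ltW y0)//; apply: le0_ler_powR.
  - by rewrite subr_le0.
  - by rewrite addr_gt0// mulr_gt0.
  have : c * x <= c * (2 * n) by rewrite ler_pM2l.
  lra.
rewrite /beta_prime_kernel; apply: le_trans (ler_pM _ _ xs ys).
- rewrite (_ : 2 `^ (1 - q) = 2 * 2 `^ (- q)); last first.
    by rewrite powRD ?powRr1// pnatr_eq0 implybT.
  rewrite le_eqVlt; apply/orP; left; apply/eqP; field.
  by rewrite gt_eqF.
- by rewrite divr_ge0 ?powR_ge0// mulr_ge0// ltW.
- by rewrite mulr_ge0 ?powR_ge0.
Qed.

(* By the doubling inequality, [2 ^ (- q) F(n)] is at most the integral of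
   [F(x) / x] over [n, 2n], which is a tail of a convergent integral. *)
Lemma cvg_beta_prime_primitive_y {q s} : 1 <= q -> 0 < s ->
  mu.-integrable `]0, +oo[ (EFin \o w c (q - 1) (s - 1)) ->
  w c (q - 1) s n.+1%:R @[n --> \oo] --> (0 : R).
Proof.
move=> q1 s0 intu; set u := w c (q - 1) (s - 1).
have u0 x : 0 <= u x by exact: beta_prime_kernel_ge0.
pose U := \int[mu]_(x in `]0, +oo[) u x.
pose A n := \int[mu]_(x in `[n.+1%:R^-1, n.+1%:R]) u x.
apply: (@squeeze_cvgr _ _ _ _ (cst 0) (fun n => 2 `^ q * (U - A n))).
- near=> n; rewrite beta_prime_kernel_ge0/=.
  set N : R := n.+1%:R; have N0 : 0 < N by [].
  have N1 : 1 <= N by rewrite ler1n.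
  have NV : N^-1 <= N by apply: (le_trans _ N1); rewrite invf_le1.
  have NN : N <= 2 * N by lra.
  have sub : `[N^-1, 2 * N]%classic `<=` (`]0, +oo[ : set R).
    by apply: subset_itv; rewrite ?bnd_simp ?invr_gt0.
  have intuN : mu.-integrable `[N^-1, 2 * N] (EFin \o u).
    exact: integrableS intu.
  have tail : \int[mu]_(x in `]N, (2 * N)]) u x <= U - A n.
    rewrite -(Rintegral_itvB intuN) ?bnd_simp// lerB//.
    exact: le_Rintegral_subset.
  have tail_sub : `]N, (2 * N)]%classic `<=` (`[N^-1, 2 * N] : set R).
    by apply: subset_itv; rewrite bnd_simp.
  have : 2 `^ (- q) * w c (q - 1) s N <= U - A n.
    apply: le_trans tail.
    (* [k] is the doubling lower bound for [u]; integrating it over an interval of length N cancels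
       the division by N. *)
    pose k := 2 `^ (- q) * w c (q - 1) s N / N.
    have muN : mu `]N, 2 * N] = N%:E.
      rewrite lebesgue_measure_itv/= lte_fin ltr_pMl// ltr1n -EFinB.
      by congr (_%:E); ring.
    rewrite (_ : _ * _ = \int[mu]_(x in `]N, 2 * N]) k); last first.
      rewrite Rintegral_cst// (_ : fine _ = N); last exact: (congr1 fine muN).
      by rewrite /k divfK// gt_eqF.
    apply: le_Rintegral => //.
    - apply/integrableP; split; first exact: measurable_cst.
      by rewrite integral_cst// [X in (_ * X)%E](_ : _ = N%:E) ?ltry.
    - exact: integrableS intuN.
    - move=> x; rewrite /= in_itv/= => /andP[Nx x2N].
      exact: beta_prime_primitive_doubling.
  by rewrite powRN ler_pdivrMl ?powR_gt0.
- exact: cvg_cst.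
- rewrite -(mulr0 (2 `^ q)) -(subrr U); apply: cvgM; first exact: cvg_cst.
  by apply: cvgB; [exact: cvg_cst|exact: cvg_Rintegral_itv_inv_nat].
Unshelve. all: by end_near. Qed.

(** The factor (1 + c x)^(1 - q) is at most 1, so F(x) is at most x^s, with s > 0. *)
Lemma cvg_beta_prime_primitive_0 {q s} : 1 <= q -> 0 < s ->
  w c (q - 1) s n.+1%:R^-1 @[n --> \oo] --> (0 : R).
Proof.
move=> q1 s0.
apply: (@squeeze_cvgr _ _ _ _ (cst 0) (fun n => n.+1%:R^-1 `^ s)).
- near=> n; rewrite beta_prime_kernel_ge0/= /beta_prime_kernel.
  have y1 : 1 <= 1 + c * n.+1%:R^-1 by rewrite lerDl mulr_ge0// ltW.
  rewrite ler_piMr ?powR_ge0// -[leRHS](powRr0 (1 + c * n.+1%:R^-1)).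
  by rewrite ler_powR// oppr_le0 subr_ge0.
- exact: cvg_cst.
- move/cvg_at_rightP : (powR_cvg0 s0); apply; split => //.
  exact: cvg_harmonic.
Unshelve. all: by end_near. Qed.

Lemma beta_prime_moment_recurrence {q s} : 1 <= q -> 0 < s ->
  mu.-integrable `]0, +oo[ (EFin \o w c q (s - 1)) ->
  mu.-integrable `]0, +oo[ (EFin \o w c q s) ->
  s * (\int[mu]_(x in `]0, +oo[) w c q (s - 1) x) =
  c * (q - 1 - s) * (\int[mu]_(x in `]0, +oo[) w c q s x).
Proof.
move=> q1 s0 int1 int2.
(* F(x) / x equals w_(s - 1) + c w_s, again by splitting off one factor 1 + c x. *)
have intu : mu.-integrable `]0, +oo[ (EFin \o w c (q - 1) (s - 1)).
  have := integrableD _ int1 (integrableZl _ c int2).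
  move=> /(_ (measurable_itv _) (measurable_itv _)).
  apply: eq_integrable => // x /set_mem/=; rewrite in_itv/= andbT => x0.
  have y0 : 0 < 1 + c * x by rewrite addr_gt0// mulr_gt0.
  rewrite -EFinM -EFinD /beta_prime_kernel; congr (_%:E).
  rewrite opprB (mul_powRB1 (1 - q) y0) (mul_powRB1 s x0) addrAC subrr add0r.
  ring.
apply/eqP; rewrite -subr_eq0; apply/eqP.
pose B n s := \int[mu]_(x in `[n.+1%:R^-1, n.+1%:R]) w c q s x.
have lhs : s * B n (s - 1) - c * (q - 1 - s) * B n s @[n --> \oo] -->
    s * (\int[mu]_(x in `]0, +oo[) w c q (s - 1) x) -
    c * (q - 1 - s) * (\int[mu]_(x in `]0, +oo[) w c q s x).
  by apply: cvgB; apply: cvgM; first [exact: cvg_cst |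
    apply: cvg_Rintegral_itv_inv_nat => // x _; exact: beta_prime_kernel_ge0].
suff rhs0 : s * B n (s - 1) - c * (q - 1 - s) * B n s @[n --> \oo] --> (0 : R).
  exact: (cvg_unique _ lhs rhs0).
have rhs : w c (q - 1) s n.+1%:R - w c (q - 1) s n.+1%:R^-1 @[n --> \oo] -->
    (0 - 0 : R).
  exact: (cvgB (cvg_beta_prime_primitive_y q1 s0 intu)
    (cvg_beta_prime_primitive_0 q1 s0)).
rewrite subrr in rhs; apply: (cvg_trans _ rhs).
apply: near_eq_cvg; near=> n.
(* At n = 0 the interval is a single point, so its endpoints are strictly ordered only from n = 1
   on. *)
have n1 : (1 : R) < n.+1%:R.
  by rewrite ltr1n ltnS; near: n; exact: nbhs_infty_gt.
by rewrite /= -Rintegral_beta_prime_itv// (lt_trans _ n1)// invf_lt1.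
Unshelve. all: by end_near. Qed.

End beta_prime.

(** * Expectations computed from a density *)

Section density.
Context {d : measure_display} {T : measurableType d} {R : realType}.
Context {P : probability T R} {X : {RV P >-> R}} {f : R -> R}.
Hypothesis Xf : has_density X f.
Local Notation mu := (@lebesgue_measure R).

(* [lebesgue_measure] lives on [measurableTypeR R], whose display differs from
   that of [R]; Radon-Nikodym derivatives need both measures on one type. *)
Let Y : T -> measurableTypeR R := X.

#[local] HB.instance Definition _ :=
  @isMeasurableFun.Build _ _ _ _ Y (measurable_funPT X).

Let mf : measurable_fun [set: R] f.
Proof. by case: Xf. Qed.

Let f_ge0 x : 0 <= f x.
Proof. by case: Xf. Qed.

Let distrE A : measurable A ->
  distribution P Y A = (\int[mu]_(x in A) (f x)%:E)%E.
Proof. by case: Xf => _ _; exact. Qed.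

Let distr_dom : distribution P Y `<< mu.
Proof.
apply/null_content_dominatesP => A mA A0; rewrite distrE//.
by apply: null_set_integral => //; exact/measurable_EFinP/measurable_funTS.
Qed.

Lemma integral_has_density : (\int[mu]_x (f x)%:E = 1)%E.
Proof. by rewrite -distrE// probability_setT. Qed.

(** The expectation is pushed forward to the law of X; its Radon-Nikodym derivative agrees almost
    everywhere with f, as both have the same integral over every measurable set. *)
Lemma expectation_has_density {g : R -> R} : measurable_fun [set: R] g ->
  g \o X \in Lfun P 1 -> ('E_P[g \o X] = \int[mu]_x (g x * f x)%:E)%E.
Proof.
move=> mg /Lfun1_integrable iX.
have mEg : measurable_fun [set: R] (EFin \o g) by exact/measurable_EFinP.
have mEf : measurable_fun [set: R] (EFin \o f) by exact/measurable_EFinP.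
have ig : (distribution P Y).-integrable [set: R] (EFin \o g).
  apply/integrableP; split => //.
  rewrite ge0_integral_distribution//; last exact/measurableT_comp.
  by have /integrableP[] := iX.
rewrite unlock -[LHS](@integral_distribution _ _ _ _ _ P Y (EFin \o g))//.
rewrite -(@Radon_Nikodym_change_of_variables _ (measurableTypeR R) R
  (distribution P Y) mu distr_dom)//.
apply: ae_eq_integral => //.
- by apply: emeasurable_funM => //; apply: (measurable_int mu);
    exact: Radon_Nikodym_integrable.
- by apply/measurable_EFinP; exact: measurable_funM.
- under [X in ae_eq _ _ _ X]eq_fun do rewrite EFinM.
  apply: ae_eqe_mul2l => /=; apply: integral_ae_eq => //=.
  + exact: Radon_Nikodym_integrable.
  + move=> A _ mA; rewrite -Radon_Nikodym_integral//=.
    exact: distrE.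
Qed.

(** Since f is nonnegative, the integral of |g f| is the expectation of |g(X)|, which is finite. *)
Lemma integrable_has_density {g : R -> R} : measurable_fun [set: R] g ->
  g \o X \in Lfun P 1 -> mu.-integrable [set: R] (fun x => (g x * f x)%:E).
Proof.
move=> mg gX; apply/integrableP; split.
  by apply/measurable_EFinP; exact: measurable_funM.
have aX : (Num.norm \o g) \o X \in Lfun P 1.
  apply/Lfun1_integrable.
  apply: (@integrable_abse _ _ _ _ _ (EFin \o (g \o X))) => //.
  exact/Lfun1_integrable.
have /= := expectation_has_density _ aX.
under eq_integral do rewrite -[in X in X%:E](ger0_norm (f_ge0 _)) -normrM.
move=> <-; last exact: measurableT_comp.
by rewrite ltey_eq expectation_fin_num.
Qed.

End density.

(** * Moments of the degenerate gamma law as kernel integrals *)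

Section degenerate_gamma.
Context {d : measure_display} {T : measurableType d} {R : realType}.
Context {P : probability T R} {lam a b : R} {X : {RV P >-> R}}.
Hypothesis b_gt0 : 0 < b.
Hypothesis Xf : degenerate_gamma_rv lam a b X.
Local Notation mu := (@lebesgue_measure R).
Local Notation w := (beta_prime_kernel (lam * b) lam^-1).
Local Notation K := (1 / degenerate_gamma_fun lam a * (b * b `^ (a - 1))).

Lemma degenerate_gamma_pdf_kernel n x : 0 < x ->
  x ^+ n * degenerate_gamma_pdf lam a b x = K * w (a - 1 + n%:R) x.
Proof.
move=> x0; rewrite /degenerate_gamma_pdf x0 /degenerate_exp /beta_prime_kernel.
rewrite (powRM _ (ltW b_gt0) (ltW x0)) (@powRD _ x (a - 1)); last first.
  by rewrite (gt_eqF x0) implybT.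
by rewrite (powR_mulrn _ (ltW x0)) mulN1r (mulrA lam); ring.
Qed.

Let moment_patch n :
  (fun x => (x ^+ n * degenerate_gamma_pdf lam a b x)%:E) =
  (fun x => (K * w (a - 1 + n%:R) x)%:E) \_ `]0, +oo[.
Proof.
apply/funext => x; rewrite patchE; case: ifPn => [|/negP].
  by rewrite inE/= in_itv/= andbT => x0; rewrite degenerate_gamma_pdf_kernel.
rewrite inE/= in_itv/= andbT => /negP/negbTE x0.
by rewrite /degenerate_gamma_pdf x0 mulr0.
Qed.

(** With K = 0 the density would vanish identically, against its total mass 1. This allows division
    by K without evaluating the gamma function. *)
Lemma degenerate_gamma_const_neq0 : K != 0.
Proof.
apply/negP => /eqP K0; have := integral_has_density Xf.
under eq_integral => x _.
  rewrite -(mul1r (degenerate_gamma_pdf _ _ _ _)) -(expr0 x); over.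
rewrite moment_patch -integral_mkcond K0.
under eq_integral do rewrite mul0r.
by rewrite integral0 => -[] /esym/eqP; rewrite oner_eq0.
Qed.

Lemma integrable_degenerate_gamma_kernel n :
  (fun t => X t ^+ n) \in Lfun P 1 ->
  mu.-integrable `]0, +oo[ (EFin \o w (a - 1 + n%:R)).
Proof.
move=> Xn; have mg : measurable_fun [set: R] (fun x : R => x ^+ n).
  exact: exprn_measurable.
have iK : mu.-integrable `]0, +oo[ (fun x => (K * w (a - 1 + n%:R) x)%:E).
  rewrite integrable_mkcond// -moment_patch.
  exact: (integrable_has_density Xf mg Xn).
have /= := integrableZl _ K^-1 iK; move=> /(_ (measurable_itv _)).
apply: eq_integrable => // x _.
by rewrite -EFinM mulKf// degenerate_gamma_const_neq0.
Qed.

Lemma degenerate_gamma_moment n : (fun t => X t ^+ n) \in Lfun P 1 ->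
  ('E_P[fun t => (X t ^+ n)%R] =
    (K * \int[mu]_(x in `]0%R, +oo[) w (a - 1 + n%:R) x)%R%:E)%E.
Proof.
move=> Xn; have mg : measurable_fun [set: R] (fun x : R => x ^+ n).
  exact: exprn_measurable.
rewrite (expectation_has_density Xf mg Xn) moment_patch -integral_mkcond.
have iw := integrable_degenerate_gamma_kernel n Xn.
rewrite -RintegralZl// /Rintegral fineK// integrable_fin_num//.
exact: (integrableZl _ K iw).
Qed.

End degenerate_gamma.

(** * The variance from the first two moments *)

Theorem theorem2 (R : realType) (d : measure_display) (T : measurableType d)
    (P : probability T R) (lam a b : R) (X : {RV P >-> R})
    (lam_gt0 : 0 < lam) (lam_lt1 : lam < 1)
    (a_gt0 : 0 < a) (a_lt : a < 1 / lam) (b_gt0 : 0 < b)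
    (X_gamma : degenerate_gamma_rv lam a b X)
    (X_L2 : (X : T -> R) \in Lfun P 2%:E) :
  ('V_P[X] = (a / b ^+ 2 *
     ((1 - lam) /
      ((1 - lam * (a + 1)) ^+ 2 * (1 - lam * (a + 2)))))%:E)%E.
Proof.
pose w := beta_prime_kernel (lam * b) lam^-1.
pose M s := \int[@lebesgue_measure R]_(x in `]0, +oo[) w s x.
pose K := 1 / degenerate_gamma_fun lam a * (b * b `^ (a - 1)).
have q1 : 1 <= lam^-1 by rewrite invf_ge1// ltW.
have c0 : 0 < lam * b by rewrite mulr_gt0.
have X0 : (fun t => X t ^+ 0) \in Lfun P 1.
  by apply: Lfun_cst.
have X1 : (fun t => X t ^+ 1) \in Lfun P 1.
  by apply: Lfun_subset12 => //; exact: fin_num_measure.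
have X2 : (fun t => X t ^+ 2) \in Lfun P 1 by exact: Lfun2_mul_Lfun1.
have i0 := integrable_degenerate_gamma_kernel b_gt0 X_gamma 0 X0.
have i1 := integrable_degenerate_gamma_kernel b_gt0 X_gamma 1 X1.
have i2 := integrable_degenerate_gamma_kernel b_gt0 X_gamma 2 X2.
rewrite addr0 in i0; rewrite subrK in i1.
rewrite (_ : a - 1 + 2 = a + 1) in i2; last by ring.
(* The zeroth moment is the total mass, which fixes K. *)
have E0 : K * M (a - 1) = 1.
  have := degenerate_gamma_moment b_gt0 X_gamma 0 X0.
  by rewrite addr0 expectation_cst => -[].
have E1 : ('E_P[X] = (K * M a)%:E)%E.
  have := degenerate_gamma_moment b_gt0 X_gamma 1 X1.
  by rewrite subrK.
have E2 : ('E_P[(X : T -> R) ^+ 2] = (K * M (a + 1))%:E)%E.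
  have := degenerate_gamma_moment b_gt0 X_gamma 2 X2.
  by rewrite (_ : a - 1 + 2 = a + 1)//; ring.
rewrite varianceE// E2 E1 -EFin_expe -EFinB; congr (_%:E).
set m1 := K * M a; set m2 := K * M (a + 1).
(* For c = lam b and q = 1 / lam, the coefficient c (q - 1 - s) is b (1 - lam (s + 1)); here s = a,
   and s = a + 1 for [m2E]. *)
have m1E : b * (1 - lam * (a + 1)) * m1 = a.
  transitivity (a * (K * M (a - 1))); last by rewrite E0 mulr1.
  rewrite mulrCA [RHS]mulrCA; congr (K * _).
  rewrite (beta_prime_moment_recurrence c0 q1 a_gt0 i0 i1).
  by rewrite -[X in _ = _ * X]/(M a); field; rewrite gt_eqF.
have m2E : b * (1 - lam * (a + 2)) * m2 = (a + 1) * m1.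
  rewrite mulrCA [RHS]mulrCA; congr (K * _).
  have a1_gt0 : 0 < a + 1 by rewrite addr_gt0.
  have := beta_prime_moment_recurrence c0 q1 a1_gt0; rewrite addrK => ->//.
  by rewrite -[X in _ = _ * X]/(M (a + 1)); field; rewrite gt_eqF.
have D1 : 1 - lam * (a + 1) != 0.
  by apply: contra_eq_neq m1E => ->; rewrite mulr0 mul0r lt_eqF.
(* This keeps the right-hand side of [m2E] nonzero, which yields [D2]. *)
have m1_neq0 : m1 != 0.
  by apply: contra_eq_neq m1E => ->; rewrite mulr0 lt_eqF.
have D2 : 1 - lam * (a + 2) != 0.
  apply: contra_eq_neq m2E => ->; rewrite mulr0 mul0r eq_sym.
  by rewrite mulf_neq0// gt_eqF// addr_gt0.
have b_neq0 : b != 0 by rewrite gt_eqF.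
have -> : m2 = (a + 1) * m1 / (b * (1 - lam * (a + 2))).
  by rewrite -m2E [RHS]mulrC mulKf// mulf_neq0.
have -> : m1 = a / (b * (1 - lam * (a + 1))).
  by rewrite -[X in _ = X / _]m1E [RHS]mulrC mulKf// mulf_neq0.
(* The numerator collapses because (a + 1) (1 - lam (a + 1)) - a (1 - lam (a + 2)) = 1 - lam. *)
by field; rewrite D1 D2 b_neq0.
Qed.
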